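(* There exists an IFS generated by finitely many homeomorphisms of the circle $S^1$ that is forward minimal but not backward minimal. Moreover, $S^1$ is a strict attractor of this IFS and, consequently, is a strict attractor that is not renderable by the deterministic chaos game.
   Context: Let $f_1,\dots,f_k$ be the generators and $\Gamma$ the semigroup they generate (all compositions of one or more generators). The IFS is forward minimal if the only non-empty closed set $B\subset S^1$ with $g(B)\subset B$ for all $g\in\Gamma$ is $B=S^1$; it is backward minimal if the only non-empty closed set $B\subset S^1$ with $\emptyset\neq g^{-1}(B)\subset B$ for all $g\in\Gamma$ is $B=S^1$. $F(K)=\bigcup_{i=1}^k f_i(K)$ for non-empty compact $K\subset S^1$. $S^1$ is a strict attractor of the IFS if $\lim_{n\to\infty}F^n(K)=S^1$ in the Vietoris topology (equivalently, the Hausdorff metric) for all non-empty compact $K\subset S^1$. $\Omega=\{1,\dots,k\}^{\mathbb{N}}$; for $\omega\in\Omega$, $f^n_\omega=f_{\omega_n}\circ\cdots\circ f_{\omega_1}$ and $O^+_\omega(x)=\{f^n_\omega(x):n\in\mathbb{N}\}$. $\mathbb{P}$ is any fixed Borel probability on $\Omega$ for which there is $0<p\le1/k$ with $\mathbb{P}(\omega_n=i\mid\omega_{n-1},\dots,\omega_1)\ge p$ for all $i$, $n$. $S^1$ is renderable by the deterministic chaos game if there is $\Omega_0\subset\Omega$ with $\mathbb{P}(\Omega_0)=1$ such that $\overline{O^+_\omega(x)}=S^1$ for all $\omega\in\Omega_0$ and $x\in S^1$. *)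

(* Defs.v *)
From HB Require Import structures.
From mathcomp Require Import all_boot all_order all_algebra.
From mathcomp Require Import all_classical all_reals all_analysis.
Import Order.TTheory GRing.Theory Num.Theory numFieldNormedType.Exports.

Set Implicit Arguments.
Unset Strict Implicit.
Unset Printing Implicit Defensive.

Local Open Scope classical_set_scope.
Local Open Scope ring_scope.

(* [set_type] carries the topology induced by the inclusion in the plane. *)
Definition circle (R : realType) :=
  set_type [set z : R * R | z.1 ^+ 2 + z.2 ^+ 2 = 1].
HB.instance Definition _ (R : realType) := PseudoMetric.on (circle R).

Definition homeomorphism (X Y : topologicalType) (f : X -> Y) : Prop :=
  continuous f /\ exists g : Y -> X, [/\ continuous g, cancel f g & cancel g f].

(* The Vietoris topology, on all subsets of X: a subbase is formed by the
   families {A | A `<=` U} and {A | A meets U} for U open. The hyperspace of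
   non-empty compact subsets is a topological subspace of this space, so that
   convergence of non-empty compact sets to a non-empty compact set may be
   computed here. *)
Definition vietoris (X : Type) : Type := set X.

Section vietoris_topology.
Variable X : topologicalType.

HB.instance Definition _ := Choice.copy (vietoris X) (set X).

Definition vietoris_subbase (i : bool * set X) : set (vietoris X) :=
  if i.1 then [set A : set X | A `<=` i.2] else [set A : set X | A `&` i.2 !=set0].

HB.instance Definition _ := @isSubBaseTopological.Build (vietoris X)
  (bool * set X)%type [set i | open i.2] vietoris_subbase.
End vietoris_topology.

Section ifs.
Variables (X : topologicalType) (k : nat) (f : 'I_k -> X -> X).

Inductive ifs_semigroup : set (X -> X) :=
| ifs_gen i : ifs_semigroup (f i)
| ifs_comp g h : ifs_semigroup g -> ifs_semigroup h -> ifs_semigroup (g \o h).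

Definition forward_minimal : Prop :=
  forall B : set X, closed B -> B !=set0 ->
    (forall g, ifs_semigroup g -> g @` B `<=` B) -> B = setT.

Definition backward_minimal : Prop :=
  forall B : set X, closed B -> B !=set0 ->
    (forall g, ifs_semigroup g -> g @^-1` B !=set0 /\ g @^-1` B `<=` B) ->
    B = setT.

Definition hutchinson (K : set X) : set X := \bigcup_(i : 'I_k) (f i @` K).

Definition whole_space_strict_attractor : Prop :=
  forall K : set X, compact K -> K !=set0 ->
    ((fun n => iter n hutchinson K : vietoris X) @ \oo --> (setT : vietoris X)).

End ifs.

(* The alphabet is {0, ..., k}: a measurable space must be inhabited in the
   library, hence k.+1 symbols. Time starts at 0: [om n] is the (n+1)-st symbol
   of the sequence [om]. *)
Definition code_space (k : nat) :=
  prod_topology (fun _ : nat => discrete_topology 'I_k.+1).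
HB.instance Definition _ (k : nat) := Topological.on (code_space k).
HB.instance Definition _ (k : nat) :=
  isPointed.Build (code_space k) (fun _ => ord0).

Definition borel_code (k : nat) := g_sigma_algebraType (@open (code_space k)).

Section chaos_game.
Variables (R : realType) (k : nat).

Definition cond_prob (P : probability (borel_code k) R)
    (A B : set (borel_code k)) : R := fine (P (A `&` B)) / fine (P B).

Definition prefix_event (n : nat) (w : nat -> 'I_k.+1) : set (borel_code k) :=
  [set om : code_space k | forall j, (j < n)%N -> om j = w j].

Definition symbol_event (n : nat) (i : 'I_k.+1) : set (borel_code k) :=
  [set om : code_space k | om n = i].

(* Conditioning on the first n symbols is conditioning on the finitely many
   events [prefix_event n w], of which only those of positive probability
   matter. For n = 0 the prefix event is the whole space. *)
Definition minorized_transitions (P : probability (borel_code k) R) : Prop :=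
  exists p : R, [/\ 0 < p, p <= k.+1%:R^-1 &
    forall (n : nat) (w : nat -> 'I_k.+1) (i : 'I_k.+1),
      (0 < P (prefix_event n w))%E ->
      p <= cond_prob P (symbol_event n i) (prefix_event n w)].

Variables (X : topologicalType) (f : 'I_k.+1 -> X -> X).

Fixpoint ifs_iter (om : nat -> 'I_k.+1) (n : nat) : X -> X :=
  if n is m.+1 then f (om m) \o ifs_iter om m else id.

Definition forward_orbit (om : nat -> 'I_k.+1) (x : X) : set X :=
  [set ifs_iter om n x | n in [set n | (0 < n)%N]].

Definition renderable (P : probability (borel_code k) R) : Prop :=
  exists Om0 : set (borel_code k),
    [/\ measurable Om0, P Om0 = 1%E &
      forall om, Om0 om -> forall x : X, closure (forward_orbit om x) = setT].

End chaos_game.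

(* Main.v *)
(* The circle is [0, 4] with its end points identified. Let h0, h1 be the
   piecewise affine homeomorphisms
     h0 : [0, 3] -> [0, 1] of slope 1/3, [3, 4] -> [1, 4] of slope 3,
     h1 : [0, 2/3] -> [0, 2] of slope 3, [2/3, 1] -> [2, 7/3] of slope 1,
          [1, 3] -> [7/3, 3] of slope 1/3, and the identity on [3, 4].
   The IFS consists of the identity, the half turn t |-> t + 2 and the inverses
   g0, g1 of h0, h1.

   Let C be the ternary Cantor set. The half turn, h0 and h1 map the nowhere
   dense set C \cup (C + 2) into itself, so its preimages under the generators
   are contained in it: the IFS is not backward minimal. By compactness, for
   each symbol sequence some point has its whole orbit in this set, which
   excludes renderability.

   The maps h0, h1 and the half turn expand every small interval by the factor
   3, possibly after an isometry, until it contains one of the end points of the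
   gaps (1, 2), (3, 4) together with a one-sided neighbourhood in the gap; such
   a neighbourhood is blown up by h0 (and the half turn) to the arc (1, 4), which
   together with its half turn covers the circle. Hence every forward orbit
   meets every interval. Since the identity is a generator, the iterates of the
   Hutchinson operator increase, and forward minimality makes them converge to
   the circle. *)
Require Import Defs.
From mathcomp Require Import all_boot all_order all_algebra.
From mathcomp Require Import all_classical all_reals all_analysis.
From mathcomp Require Import ring lra.
Import Order.TTheory GRing.Theory Num.Theory numFieldNormedType.Exports.

Set Implicit Arguments.
Unset Strict Implicit.
Unset Printing Implicit Defensive.

Local Open Scope classical_set_scope.
Local Open Scope ring_scope.

(** * Parametrization of the circle *)

Lemma injective_continuous_hausdorff (X Y : topologicalType) (f : X -> Y) :
  injective f -> continuous f -> hausdorff_space Y -> hausdorff_space X.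
Proof.
move=> fI fc hY p q pq; apply/fI/hY => A B /fc fA /fc fB.
by have [x [Ax Bx]] := pq _ _ fA fB; exists (f x).
Qed.

Section circle_parametrization.
Variable R : realType.
Implicit Types s t : R.

(** With this factor the circle has length 4, so the half turn is [t + 2] and the gaps have integral
    end points. *)
Definition angle t : R := pi / 2 * t.

Lemma cos_sin_circle t :
  [set z : R * R | z.1 ^+ 2 + z.2 ^+ 2 = 1] (cos (angle t), sin (angle t)).
Proof. exact: cos2Dsin2. Qed.

Definition expc t : circle R :=
  exist (fun z => z \in [set z : R * R | z.1 ^+ 2 + z.2 ^+ 2 = 1])
    _ (mem_set (cos_sin_circle t)).

Lemma expcE s t : expc s = expc t <->
  cos (angle s) = cos (angle t) /\ sin (angle s) = sin (angle t).
Proof.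
split=> [/(congr1 val)[-> ->]//|[ec es]].
by apply/val_inj; rewrite /= ec es.
Qed.

Lemma expcD4 t : expc (t + 4) = expc t.
Proof.
apply/expcE; have -> : angle (t + 4) = angle t + pi *+ 2.
  by rewrite /angle -mulr_natr; move: pi => p; field.
by rewrite cosD2pi sinD2pi.
Qed.

Lemma cos_sin_angle_surj (x y : R) : x ^+ 2 + y ^+ 2 = 1 ->
  exists t, [/\ 0 <= t < 4, cos (angle t) = x & sin (angle t) = y].
Proof.
move=> xy; have x11 : -1 <= x <= 1 by apply/andP; split; nra.
have sx : sin (acos x) = Num.sqrt (y ^+ 2).
  by rewrite sin_acos//; congr Num.sqrt; lra.
have cx : cos (acos x) = x by rewrite acosK// in_itv.
have := acos_lepi x11; have := acos_ge0 x11; have := pi_gt0 R.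
have := @cosD2pi R; have := @sinD2pi R; rewrite /angle.
move: (acos x) pi sx cx => a p sx cx sin2p cos2p p0 a0 ap.
have [y0|y0] := leP 0 y.
  exists (2 / p * a); have -> : p / 2 * (2 / p * a) = a by field; rewrite gt_eqF.
  rewrite cx sx sqrtr_sqr ger0_norm//; split => //.
  apply/andP; split; first by rewrite mulr_ge0// divr_ge0// ltW.
  by rewrite mulrAC ltr_pdivrMr//; nra.
(* Positivity of [a] keeps the parameter of the reflected angle [- a + p *+ 2] strictly below 4. *)
have a1 : a != 0.
  by apply/eqP => aE; move: sx; rewrite aE sin0 sqrtr_sqr ltr0_norm//; lra.
have {}a1 : 0 < a by rewrite lt_neqAle eq_sym a1.
have -> : y = - sin a by rewrite sx sqrtr_sqr ltr0_norm ?opprK.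
exists (4 - 2 / p * a).
have -> : p / 2 * (4 - 2 / p * a) = - a + p *+ 2.
  by rewrite -mulr_natr; field; rewrite gt_eqF.
have q0 : 0 < 2 / p * a by rewrite mulr_gt0// divr_gt0.
have q4 : 2 / p * a <= 4 by rewrite mulrAC ler_pdivrMr//; nra.
by rewrite sin2p cos2p cosN sinN; split => //; apply/andP; split; lra.
Qed.

Lemma expc_surj (z : circle R) : exists t, 0 <= t < 4 /\ expc t = z.
Proof.
case: z => [[x y] /= zP]; have [t [t4 cx sy]] := cos_sin_angle_surj (set_mem zP).
by exists t; split=> //; apply/val_inj; rewrite /= cx sy.
Qed.

(** The difference [d] of the angles lies in [0, 2 pi) and has cosine 1. Since [cos] is injective on
    [0, pi], either [d] or its reflection [pi *+ 2 - d] vanishes, and the latter is excluded. *)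
Lemma expc_inj s t : 0 <= s < 4 -> 0 <= t < 4 -> expc s = expc t -> s = t.
Proof.
wlog st : s t / s <= t.
  move=> H s4 t4 e; have [/H|/ltW/H ts] := leP s t; first exact.
  exact/esym/ts.
move=> s4 t4 /expcE[ec es].
set d := angle t - angle s.
have cd : cos d = 1 by rewrite cosB ec es -(cos2Dsin2 (angle t)) !expr2.
have dE : d = pi / 2 * (t - s) by rewrite mulrBr.
have pi0 := pi_gt0 R; have pi20 : 0 < pi / 2 :> R by rewrite divr_gt0.
have d0 : 0 <= d by rewrite dE mulr_ge0 ?subr_ge0// ltW.
have d2 : d < pi *+ 2.
  rewrite dE (_ : pi *+ 2 = pi / 2 * 4) ?ltr_pM2l//; first by clear -s4 t4; lra.
  by rewrite -mulr_natr; move: pi => p; field.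
suff /eqP : d = 0.
  by rewrite dE mulf_eq0 gt_eqF//= subr_eq0 => /eqP.
have [dpi|dpi] := leP d pi.
  by apply: cos_inj; rewrite ?in_itv/= ?d0 ?lexx ?cos0// ltW.
have : pi *+ 2 - d = 0.
  apply: cos_inj; rewrite ?in_itv/= ?lexx ?(ltW pi0)//.
    by rewrite subr_ge0 (ltW d2) lerBlDr mulr2n lerD2l ltW.
  by rewrite cos0 addrC cosD2pi cosN.
by move=> /subr0_eq d2'; move: d2; rewrite d2' ltxx.
Qed.

Lemma continuous_expc : continuous expc.
Proof.
have ca : continuous angle.
  by move=> t; apply: cvgM; [exact: cvg_cst|exact: cvg_id].
have cf : continuous (fun t => (cos (angle t), sin (angle t)) : R * R).
  move=> t; apply: (@cvg_pair _ _ _ _ (nbhs _) (nbhs _)).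
    by apply: (continuous_comp (ca _)); exact: continuous_cos.
  by apply: (continuous_comp (ca _)); exact: continuous_sin.
apply/continuousP => _ [W oW <-].
by move/continuousP: cf => /(_ W oW).
Qed.

Lemma hausdorff_circle : hausdorff_space (circle R).
Proof.
apply: (injective_continuous_hausdorff (f := val : circle R -> R * R)%type).
- exact: val_inj.
- exact: initial_continuous.
- exact: norm_hausdorff.
Qed.

Lemma compact_expc (a b : R) : compact (expc @` `[a, b]).
Proof.
apply: continuous_compact; last exact: segment_compact.
exact/continuous_subspaceT/continuous_expc.
Qed.

End circle_parametrization.

(** * Iterated function systems *)

Lemma image_closure (X Y : topologicalType) (f : X -> Y) (A : set X) :
  continuous f -> f @` closure A `<=` closure (f @` A).
Proof.
move=> /continuous_closedP fc _ [x Ax <-].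
suff : (f @^-1` closure (f @` A)) x by [].
have /closure_id E := fc _ (@closed_closure _ (f @` A)); rewrite E.
by apply: closureS Ax => y Ay; apply/subset_closure; exists y.
Qed.

(** A neighbourhood of the whole space contains a finite intersection of subbasic ones. Those of the
    form [A <= U] force [U] to be the whole space, so only the condition of meeting open sets
    remains. *)
Lemma cvg_vietorisT (X : topologicalType) (A : nat -> set X) :
  (forall U, open U -> U !=set0 -> \forall n \near \oo, A n `&` U !=set0) ->
  (A : nat -> vietoris X) @ \oo --> (setT : vietoris X).
Proof.
move=> AU O; rewrite (@nbhsE (vietoris X)) => -[_ [[B sB <-] [C BC CT]] BO].
rewrite nbhs_filterE; apply: filterS BO _.
suff : \forall n \near \oo, C (A n).
  by apply: filterS => n CA; exists C.
move: CT; have [D sD <-] := sB _ BC => DT.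
apply: filter_bigI => -[b U] iD; have /set_mem/= oU := sD _ iD.
move: (DT _ iD); rewrite /vietoris_subbase/=; case: b iD => /= _ UT.
  by apply: filterE => n; exact: subset_trans UT.
by case: UT => u [_ Uu]; apply: AU => //; exists u.
Qed.

Section ifs_theory.
Variables (X : topologicalType) (k : nat) (f : 'I_k -> X -> X).

Lemma forward_minimal_generators :
  (forall K, closed K -> K !=set0 -> (forall i, f i @` K `<=` K) -> K = setT) ->
  forward_minimal f.
Proof. by move=> H B cB B0 fB; apply: H => // i; apply/fB/ifs_gen. Qed.

(** Surjectivity and backward invariance of [B] both pass from the generators to compositions;
    surjectivity makes the preimages of [B] non-empty. *)
Lemma not_backward_minimal (B : set X) : (forall i y, exists x, f i x = y) ->
  closed B -> B !=set0 -> B != setT -> (forall i, f i @^-1` B `<=` B) ->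
  ~ backward_minimal f.
Proof.
move=> fsurj cB [b Bb] /eqP BT fB /(_ B) bm; apply: BT; apply: bm => //.
  by exists b.
suff gB g : ifs_semigroup f g -> (forall y, exists x, g x = y) /\ g @^-1` B `<=` B.
  move=> g /gB[gs gBB]; split => //; have [x gx] := gs b.
  by exists x; rewrite /preimage/= gx.
elim=> [i|{}g h _ [gs gBB] _ [hs hBB]]; first by split => //; exact: fsurj.
split=> [y|x /= Bx]; last exact/hBB/gBB.
by have [z <-] := gs y; have [x <-] := hs z; exists x.
Qed.

Lemma sub_iter_hutchinson (K : set X) (n m : nat) : (exists i, f i = id) ->
  iter n (hutchinson f) K `<=` iter (m + n) (hutchinson f) K.
Proof.
move=> [i fi]; elim: m => [|m IH]//; apply: (subset_trans IH) => x Kx.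
by exists i => //; exists x; rewrite ?fi.
Qed.

(** The exponent is the length of a word in the generators that represents [g]. *)
Lemma semigroup_iter_hutchinson g : ifs_semigroup f g ->
  exists n, forall K, g @` K `<=` iter n (hutchinson f) K.
Proof.
elim=> [i|{}g h _ [n gn] _ [m hm]]; first by exists 1 => K x Kx; exists i.
exists (n + m)%N => K; rewrite iterD -image_comp; apply: subset_trans (gn _).
exact/image_subset.
Qed.

Lemma forward_minimal_strict_attractor :
  (forall i, continuous (f i)) -> (exists i, f i = id) ->
  forward_minimal f -> whole_space_strict_attractor f.
Proof.
move=> fc fid fm K _ [x Kx]; apply: cvg_vietorisT => U oU U0.
have gc g : ifs_semigroup f g -> continuous g.
  elim=> [i|{}g h _ gc _ hc]; first exact: fc.
  by move=> y; apply: continuous_comp; [exact: hc|exact: gc].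
have [i fi] := fid.
(* The closure of the semigroup orbit of [x] is forward invariant. Hence some [g] sends [x] into
   [U], and the increasing iterates keep that point. *)
have clT : closure [set g x | g in ifs_semigroup f] = setT.
  apply: fm; first exact: closed_closure.
    by exists (f i x); apply/subset_closure; exists (f i) => //; exact: ifs_gen.
  move=> g gS; apply: subset_trans (image_closure (gc _ gS)) _.
  by apply: closureS => _ [_ [h hS <-] <-]; exists (g \o h) => //; exact: ifs_comp.
have [u Uu] := U0; have : closure [set g x | g in ifs_semigroup f] u by rewrite clT.
move=> /(_ U (open_nbhs_nbhs (conj oU Uu)))[_ [[g gS <-] Ugx]].
have [n gn] := semigroup_iter_hutchinson gS.
exists n => // m /= nm; exists (g x); split=> //.
by rewrite -(subnK nm); apply: sub_iter_hutchinson => //; apply: gn; exists x.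
Qed.

End ifs_theory.

(** Fix one sequence [om] and choose [x n] whose n-th iterate is [b]. Backward invariance puts all
    earlier iterates of [x n] in [B], so the orbit of a cluster point [y] stays in [B]. *)
Lemma not_renderable (R : realType) (X : topologicalType) (k : nat)
    (f : 'I_k.+1 -> X -> X) (B : set X) (P : probability (borel_code k) R) :
  compact [set: X] -> (forall i, continuous (f i)) ->
  (forall i y, exists x, f i x = y) ->
  closed B -> B !=set0 -> B != setT -> (forall i, f i @^-1` B `<=` B) ->
  ~ renderable f P.
Proof.
move=> cX fc fsurj cB [b Bb] /eqP BT fB [Om [_ POm orb]].
have [om Omom] : Om !=set0.
  by apply/set0P/negP => /eqP Om0; move: POm; rewrite Om0 measure0 => /eqP; rewrite eq_sym onee_eq0.
have gsurj n y : exists x, ifs_iter f om n x = y.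
  elim: n y => [y|n IH y]; first by exists y.
  by have [z <-] := fsurj (om n) y; have [x <-] := IH z; exists x.
have gc n : continuous (ifs_iter f om n).
  elim: n => [x|n IH x] /=; first exact: cvg_id.
  by apply: continuous_comp; [exact: IH|exact: fc].
have gB n m : ifs_iter f om (m + n) @^-1` B `<=` ifs_iter f om n @^-1` B.
  by elim: m => [|m IH]//= x /fB/IH.
have [x xB] := choice (fun n => gsurj n b).
have [y [_ yx]] := cX (x @ \oo) _ filterT.
apply: BT; apply/seteqP; split => // z _.
have : closure (forward_orbit f om y) z by rewrite orb.
have BE : B = closure B by apply/closure_id.
rewrite BE; apply: closureS => _ [n _ <-].
have /closure_id E := (continuous_closedP _).1 (gc n) _ cB.
suff : (ifs_iter f om n @^-1` B) y by [].
(* The tail of the sequence from index [n] on lies in the closed n-th preimage of [B], hence so does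
   [y]. *)
rewrite E; move: yx; rewrite clusterE; apply; exists n => // m /= nm.
apply: (gB _ (m - n)%N).
by rewrite subnK// /preimage/= xB.
Qed.

(** * Expansion of intervals *)

(* In the application, [Q t] says that the point with parameter [t] lies in a given
   forward invariant set; [Q0] is invariance under g0, [Q1] and [Q2] under g1. *)
Section expansion.
Variables (R : realType) (Q : R -> Prop).
Hypothesis Qex : exists t, 0 <= t < 4 /\ Q t.
Hypothesis QD2 : forall t, 0 <= t <= 2 -> Q t -> Q (t + 2).
Hypothesis QB2 : forall t, 2 <= t <= 4 -> Q t -> Q (t - 2).
Hypothesis Q0 : forall t, 1 <= t <= 4 -> Q t -> Q ((t + 8) / 3).
Hypothesis Q1 : forall t, 0 <= t <= 2 -> Q t -> Q (t / 3).
Hypothesis Q2 : forall t, 2 <= t <= 7 / 3 -> Q t -> Q (t - 4 / 3).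

Let meets (a b : R) := exists t, a < t < b /\ Q t.

Lemma meets14 : meets 1 4.
Proof.
have [t [t4 Qt]] := Qex; have [t1|t1] := leP t 1.
  by exists (t + 2); split; [lra|apply: QD2 => //; lra].
by exists t; split => //; lra.
Qed.

Lemma meets34 : meets 3 4.
Proof.
have [t [t4 Qt]] := meets14.
by exists ((t + 8) / 3); split; [lra|apply: Q0 => //; lra].
Qed.

(** [h0] fixes 4 and triples the interval until it covers the gap (3, 4). The exponent bounds the
    number of steps; the factor 2, weaker than 3, is enough for the count. *)
Lemma meets_left4 (n : nat) (x : R) : 0 < x <= 1 -> 1 <= 2 ^+ n * x ->
  meets (4 - x) 4.
Proof.
elim: n x => [|n IH] x x01 nx.
  have [t [t4 Qt]] := meets34; exists t; split => //.
  by move: nx; rewrite expr0 mul1r => nx; lra.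
suff [t [t4 [t3 Qt]]] : exists t, 4 - 3 * x < t < 4 /\ 1 <= t /\ Q t.
  by exists ((t + 8) / 3); split; [lra|apply: Q0 => //; lra].
have [x3|x3] := leP (3 * x) 1.
  have [||t [t4 Qt]] := IH (3 * x); first by lra.
    by move: nx; rewrite exprS; have : 0 < 2 ^+ n :> R by []; nra.
  by exists t; split => //; split => //; lra.
by have [t [t4 Qt]] := meets34; exists t; split; [lra|split => //; lra].
Qed.

(** Same expansion at the other end of the gap: [h0] sends 3 to 1, and the half turn brings it back
    to 3. *)
Lemma meets_right3 (n : nat) (x : R) : 0 < x <= 1 -> 1 <= 2 ^+ n * x ->
  meets 3 (3 + x).
Proof.
elim: n x => [|n IH] x x01 nx.
  have [t [t4 Qt]] := meets34; exists t; split => //.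
  by move: nx; rewrite expr0 mul1r => nx; lra.
suff [t [t4 [t3 Qt]]] : exists t, 3 < t < 3 + 3 * x /\ t <= 4 /\ Q t.
  exists ((t - 2 + 8) / 3); split; first by lra.
  by apply: Q0; [lra|apply: QB2 => //; lra].
have [x3|x3] := leP (3 * x) 1.
  have [||t [t4 Qt]] := IH (3 * x); first by lra.
    by move: nx; rewrite exprS; have : 0 < 2 ^+ n :> R by []; nra.
  by exists t; split => //; split => //; lra.
by have [t [t4 Qt]] := meets34; exists t; split; [lra|split => //; lra].
Qed.

Lemma exists_pow2 (x : R) : 0 < x -> exists n, 1 <= 2 ^+ n * x.
Proof.
move=> x0; exists (Num.bound x^-1); rewrite -ler_pdivrMr// div1r.
exact/ltW/upper_nthrootP.
Qed.

Lemma meetsD2 (a b : R) : 0 <= a -> b <= 2 -> meets (a + 2) (b + 2) -> meets a b.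
Proof.
move=> a0 b2 [t [tab Qt]].
by exists (t - 2); split; [lra|apply: QB2 => //; lra].
Qed.

Lemma meetsB2 (a b : R) : 2 <= a -> b <= 4 -> meets (a - 2) (b - 2) -> meets a b.
Proof.
move=> a0 b2 [t [tab Qt]].
by exists (t + 2); split; [lra|apply: QD2 => //; lra].
Qed.

Lemma meets_left2 (x : R) : 0 < x <= 1 -> meets (2 - x) 2.
Proof.
move=> x01; have [n nx] : exists n, 1 <= 2 ^+ n * x by apply: exists_pow2; lra.
have [t [tx Qt]] := meets_left4 x01 nx.
by exists (t - 2); split; [lra|apply: QB2 => //; lra].
Qed.

Lemma meets_right1 (x : R) : 0 < x <= 1 -> meets 1 (1 + x).
Proof.
move=> x01; have [n nx] : exists n, 1 <= 2 ^+ n * x by apply: exists_pow2; lra.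
have [t [tx Qt]] := meets_right3 x01 nx.
by exists (t - 2); split; [lra|apply: QB2 => //; lra].
Qed.

Lemma sub_meets (a b c d : R) : a <= c -> d <= b -> meets c d -> meets a b.
Proof. by move=> ac db [t [tcd Qt]]; exists t; split => //; lra. Qed.

(** Induction on the number of expansions: an expanding branch triples the length, while an interval
    on which no such branch is available contains a one-sided neighbourhood of a gap end point, up
    to the half turn and [h1]. *)
Lemma meets_itv (a b : R) : 0 <= a -> a < b -> b <= 4 -> meets a b.
Proof.
move=> a0 ab b4.
have [n] : exists n, 1 <= 2 ^+ n * ((b - a) / 4) by apply: exists_pow2; lra.
(* For [n = 0] the length is at least 4, so the interval is all of (0, 4). *)
elim: n a b a0 ab b4 => [|n IH] a b a0 ab b4 nab.
  apply: (@sub_meets _ _ 1 4); last exact: meets14.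
    by move: nab; rewrite expr0 mul1r; lra.
  by move: nab; rewrite expr0 mul1r; lra.
have p2 : 0 < 2 ^+ n :> R by [].
have {nab IH}IH c d : 0 <= c -> d <= 4 -> d - c = 3 * (b - a) -> meets c d.
  move=> c0 d4 E; apply: IH => //; first by lra.
  by move: nab; rewrite E exprS; nra.
have IH34 c d : 3 <= c -> d <= 4 -> d - c = b - a -> meets c d.
  move=> c3 d4 E; have [|||t [tcd Qt]] := IH (3 * c - 8) (3 * d - 8); try lra.
  by exists ((t + 8) / 3); split; [lra|apply: Q0 => //; lra].
have IH1 c d : 0 <= c -> d <= 2 / 3 -> d - c = b - a -> meets c d.
  move=> c3 d4 E; have [|||t [tcd Qt]] := IH (3 * c) (3 * d); try lra.
  by exists (t / 3); split; [lra|apply: Q1 => //; lra].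
have IH01 c d : 0 <= c -> d <= 1 -> c < d -> d - c = b - a -> meets c d.
  move=> c0 d1 cd E; have [d23|d23] := leP d (2 / 3); first exact: IH1.
  have [c23|c23] := leP (2 / 3) c.
    (* On [2/3, 1], [h1] followed by the half turn is the translation by -2/3, an isometry onto
       [0, 1/3]. *)
    have [|||t [tcd Qt]] := IH1 (c - 2 / 3) (d - 2 / 3); try lra.
    exists (t + 2 - 4 / 3); split; first by lra.
    by apply: Q2; [lra|apply: QD2 => //; lra].
  (* Now 2/3 is interior and [h1] maps (c, 2/3) onto (3c, 2), a left neighbourhood of the gap end
     point 2. *)
  have [c13|c13] := leP (1 / 3) c.
    have [|t [tx Qt]] := @meets_left2 (2 - 3 * c); first by lra.
    by exists (t / 3); split; [lra|apply: Q1 => //; lra].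
  have [|t [tx Qt]] := @meets_left2 1; first by lra.
  by exists (t / 3); split; [lra|apply: Q1 => //; lra].
have IH02 c d : 0 <= c -> d <= 2 -> c < d -> d - c = b - a -> meets c d.
  move=> c0 d2 cd E; have [d1|d1] := leP d 1; first exact: IH01.
  have [c1|c1] := leP 1 c; first by apply: meetsD2 => //; apply: IH34; lra.
  (* Here 1 is interior, and (1, d) lies in the gap (1, 2). *)
  by apply: (@sub_meets _ _ 1 (1 + (d - 1))); [lra|lra|apply: meets_right1; lra].
have [b2|b2] := leP b 2; first by apply: IH02.
have [a2|a2] := leP 2 a; first by apply: meetsB2 => //; apply: IH02; lra.
have [a1|a1] := leP 1 a.
  by apply: (@sub_meets _ _ (2 - (2 - a)) 2); [lra|lra|apply: meets_left2; lra].
by apply: (@sub_meets _ _ (2 - 1) 2); [lra|lra|apply: meets_left2; lra].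
Qed.

End expansion.

(** * The example *)

Section circle_maps.
Variable R : realType.
Implicit Types (s t : R) (F G : R -> R).

Lemma image_expc_setT : @expc R @` `[0, 4] = setT.
Proof.
apply/seteqP; split => // z _; have [t [t4 <-]] := expc_surj z.
by exists t => //=; rewrite in_itv/=; lra.
Qed.

Lemma compact_circle : compact [set: circle R].
Proof. by rewrite -image_expc_setT; exact: compact_expc. Qed.

(** * Lifting interval maps to the circle *)

Definition arg (z : circle R) : R := projT1 (cid (expc_surj z)).

Definition lift F (z : circle R) : circle R := expc (F (arg z)).

Lemma argE (z : circle R) : 0 <= arg z < 4 /\ expc (arg z) = z.
Proof. exact: (projT2 (cid (expc_surj z))). Qed.

(** Equal values of [F] at 0 and 4 on the circle extend the formula to [t = 4], where [arg] returns
    0. *)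
Lemma lift_expc F t : expc (F 0) = expc (F 4) -> 0 <= t <= 4 ->
  lift F (expc t) = expc (F t).
Proof.
move=> F04 t4; rewrite /lift; have [a4 ea] := argE (expc t).
have [t4'|t4'] := ltP t 4; first by rewrite (expc_inj _ _ ea)//; lra.
have tE : t = 4 by lra.
have e04 : expc (arg (expc t)) = expc 0 by rewrite ea tE -[4]add0r expcD4.
by rewrite (expc_inj a4 _ e04) ?tE//; lra.
Qed.

(* By compactness, [expc] maps closed subsets of [0, 4] to closed sets. *)
Lemma continuous_lift F : expc (F 0) = expc (F 4) -> continuous F ->
  continuous (lift F).
Proof.
move=> F04 Fc; apply/continuous_closedP => D cD.
have -> : lift F @^-1` D = @expc R @` (`[0, 4] `&` (@expc R \o F) @^-1` D).
  apply/seteqP; split => [z Dz|_ [t [t4 /= Dt] <-]].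
    have [a4 az] := argE z; exists (arg z) => //; split => //=.
    by rewrite in_itv/=; lra.
  by rewrite /preimage/= lift_expc//; move: t4; rewrite /= in_itv.
apply: compact_closed; first exact: hausdorff_circle.
apply: continuous_compact; first exact/continuous_subspaceT/continuous_expc.
apply: compact_closedI; first exact: segment_compact.
apply: preimage_closed cD => t _.
by apply: continuous_comp; [exact: Fc|exact: continuous_expc].
Qed.

(** Keeping parameters in [0, 4] makes lifting compatible with composition. The half turn leaves
    this interval and is treated apart. *)
Definition stable04 F := [/\ F 0 = 0, F 4 = 4 &
  forall t, 0 <= t <= 4 -> 0 <= F t <= 4].

Lemma expc04 : expc 0 = expc (4 : R).
Proof. by rewrite -[4]add0r expcD4. Qed.

Lemma lift_stable04 F t : stable04 F -> 0 <= t <= 4 ->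
  lift F (expc t) = expc (F t).
Proof. by move=> [F0 F4 _] t4; rewrite lift_expc// F0 F4 expc04. Qed.

Lemma lift_cancel F G : stable04 F -> stable04 G -> cancel F G ->
  cancel (lift F) (lift G).
Proof.
move=> F04 G04 FG z; have [t [t4 <-]] := expc_surj z.
have {}t4 : 0 <= t <= 4 by lra.
rewrite [lift F _]lift_stable04// lift_stable04 ?FG//.
by case: F04 => _ _; apply.
Qed.

Definition half_turn := lift (fun t => t + 2).

Lemma half_turn_expc t : 0 <= t <= 4 -> half_turn (expc t) = expc (t + 2).
Proof.
move=> t4; rewrite /half_turn lift_expc// -expcD4; congr expc; lra.
Qed.

Lemma half_turn_expc_sub t : 2 <= t <= 4 -> half_turn (expc t) = expc (t - 2).
Proof.
move=> t4; rewrite half_turn_expc; last by lra.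
by rewrite -[in RHS]expcD4; congr expc; lra.
Qed.

Lemma half_turnK : involutive half_turn.
Proof.
move=> z; have [t [t4 <-]] := expc_surj z; have [t2|t2] := leP t 2.
  by rewrite half_turn_expc ?half_turn_expc_sub ?addrK//; lra.
by rewrite half_turn_expc_sub ?half_turn_expc ?subrK//; lra.
Qed.

(** * The piecewise affine maps and their inverses *)

Definition g0 t := Num.min (3 * t) ((t + 8) / 3).
Definition h0 t := Num.max (t / 3) (3 * t - 8).
(** The inner [Num.max] is the convex graph on [0, 3]; the outer [Num.min] turns the map into the
    identity elsewhere. Such lattice formulas give continuity without gluing. *)
Definition g1 t := Num.min t (Num.max (t / 3) (Num.max (t - 4 / 3) (3 * t - 6))).
Definition h1 t := Num.max t (Num.min (3 * t) (Num.min (t + 4 / 3) (t / 3 + 2))).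

Lemma g0_lo t : t <= 1 -> g0 t = 3 * t.
Proof. by move=> ?; rewrite /g0 min_l; lra. Qed.

Lemma g0_hi t : 1 <= t -> g0 t = (t + 8) / 3.
Proof. by move=> ?; rewrite /g0 min_r; lra. Qed.

Lemma h0_lo t : t <= 3 -> h0 t = t / 3.
Proof. by move=> ?; rewrite /h0 max_l; lra. Qed.

Lemma h0_hi t : 3 <= t -> h0 t = 3 * t - 8.
Proof. by move=> ?; rewrite /h0 max_r; lra. Qed.

Lemma g0K : cancel g0 h0.
Proof.
move=> t; have [t1|t1] := leP t 1.
  by rewrite g0_lo// h0_lo; lra.
by rewrite g0_hi ?h0_hi; lra.
Qed.

Lemma h0K : cancel h0 g0.
Proof.
move=> t; have [t3|t3] := leP t 3.
  by rewrite h0_lo// g0_lo; lra.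
by rewrite h0_hi ?g0_hi; lra.
Qed.

Lemma g1_neg t : t <= 0 -> g1 t = t.
Proof. by move=> ?; rewrite /g1 [Num.max (t - _) _]max_l ?[Num.max (t / 3) _]max_l ?min_l; lra. Qed.

Lemma g1_lo t : 0 <= t <= 2 -> g1 t = t / 3.
Proof. by move=> ?; rewrite /g1 [Num.max (t - _) _]max_l ?[Num.max (t / 3) _]max_l ?min_r; lra. Qed.

Lemma g1_mid t : 2 <= t <= 7 / 3 -> g1 t = t - 4 / 3.
Proof. by move=> ?; rewrite /g1 [Num.max (t - _) _]max_l ?[Num.max (t / 3) _]max_r ?min_r; lra. Qed.

Lemma g1_hi t : 7 / 3 <= t <= 3 -> g1 t = 3 * t - 6.
Proof. by move=> ?; rewrite /g1 [Num.max (t - _) _]max_r ?[Num.max (t / 3) _]max_r ?min_r; lra. Qed.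

Lemma g1_ge3 t : 3 <= t -> g1 t = t.
Proof. by move=> ?; rewrite /g1 [Num.max (t - _) _]max_r ?[Num.max (t / 3) _]max_r ?min_l; lra. Qed.

Lemma h1_neg t : t <= 0 -> h1 t = t.
Proof. by move=> ?; rewrite /h1 [Num.min (t + _) _]min_l ?[Num.min (3 * t) _]min_l ?max_l; lra. Qed.

Lemma h1_lo t : 0 <= t <= 2 / 3 -> h1 t = 3 * t.
Proof. by move=> ?; rewrite /h1 [Num.min (t + _) _]min_l ?[Num.min (3 * t) _]min_l ?max_r; lra. Qed.

Lemma h1_mid t : 2 / 3 <= t <= 1 -> h1 t = t + 4 / 3.
Proof. by move=> ?; rewrite /h1 [Num.min (t + _) _]min_l ?[Num.min (3 * t) _]min_r ?max_r; lra. Qed.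

Lemma h1_hi t : 1 <= t <= 3 -> h1 t = t / 3 + 2.
Proof. by move=> ?; rewrite /h1 [Num.min (t + _) _]min_r ?[Num.min (3 * t) _]min_r ?max_r; lra. Qed.

Lemma h1_ge3 t : 3 <= t -> h1 t = t.
Proof. by move=> ?; rewrite /h1 [Num.min (t + _) _]min_r ?[Num.min (3 * t) _]min_r ?max_l; lra. Qed.

Lemma g1K : cancel g1 h1.
Proof.
move=> t; have [t0|t0] := leP t 0; first by rewrite g1_neg// h1_neg.
have [t2|t2] := leP t 2; first by rewrite g1_lo ?h1_lo; lra.
have [t7|t7] := leP t (7 / 3); first by rewrite g1_mid ?h1_mid; lra.
have [t3|t3] := leP t 3; first by rewrite g1_hi ?h1_hi; lra.
by rewrite g1_ge3 ?h1_ge3; lra.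
Qed.

Lemma h1K : cancel h1 g1.
Proof.
move=> t; have [t0|t0] := leP t 0; first by rewrite h1_neg// g1_neg.
have [t2|t2] := leP t (2 / 3); first by rewrite h1_lo ?g1_lo; lra.
have [t1|t1] := leP t 1; first by rewrite h1_mid ?g1_mid; lra.
have [t3|t3] := leP t 3; first by rewrite h1_hi ?g1_hi; lra.
by rewrite h1_ge3 ?g1_ge3; lra.
Qed.

Lemma continuous_affine (a b : R) : continuous (fun t => a * t + b).
Proof.
by move=> t; apply: cvgD; [apply: cvgM; [exact: cvg_cst|exact: cvg_id]|exact: cvg_cst].
Qed.

Lemma continuous_eq_affine (a b : R) F : (forall t, F t = a * t + b) -> continuous F.
Proof. by move=> FE; rewrite (funext FE); exact: continuous_affine. Qed.

Ltac continuity_affine a b := apply: (@continuous_eq_affine a b) => ?; lra.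

Lemma continuous_g0 : continuous g0.
Proof.
move=> t; apply: (@continuous_min R R (fun t => 3 * t) (fun t => (t + 8) / 3)).
  by continuity_affine (3 : R) (0 : R).
by continuity_affine (3^-1 : R) (8 / 3 : R).
Qed.

Lemma continuous_h0 : continuous h0.
Proof.
move=> t; apply: (@continuous_max R R (fun t => t / 3) (fun t => 3 * t - 8)).
  by continuity_affine (3^-1 : R) (0 : R).
by continuity_affine (3 : R) (- 8 : R).
Qed.

Lemma continuous_g1 : continuous g1.
Proof.
move=> t; apply: (@continuous_min R R id); first exact: cvg_id.
apply: (@continuous_max R R (fun t => t / 3)).
  by continuity_affine (3^-1 : R) (0 : R).
apply: (@continuous_max R R (fun t => t - 4 / 3) (fun t => 3 * t - 6)).
  by continuity_affine (1 : R) (- (4 / 3) : R).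
by continuity_affine (3 : R) (- 6 : R).
Qed.

Lemma continuous_h1 : continuous h1.
Proof.
move=> t; apply: (@continuous_max R R id); first exact: cvg_id.
apply: (@continuous_min R R (fun t => 3 * t)).
  by continuity_affine (3 : R) (0 : R).
apply: (@continuous_min R R (fun t => t + 4 / 3) (fun t => t / 3 + 2)).
  by continuity_affine (1 : R) (4 / 3 : R).
by continuity_affine (3^-1 : R) (2 : R).
Qed.

Lemma g0_stable04 : stable04 g0.
Proof.
split=> [||t t4]; [by rewrite g0_lo; lra|by rewrite g0_hi; lra|].
by have [t1|t1] := leP t 1; [rewrite g0_lo|rewrite g0_hi]; lra.
Qed.

Lemma h0_stable04 : stable04 h0.
Proof.
split=> [||t t4]; [by rewrite h0_lo; lra|by rewrite h0_hi; lra|].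
by have [t3|t3] := leP t 3; [rewrite h0_lo|rewrite h0_hi]; lra.
Qed.

Lemma g1_stable04 : stable04 g1.
Proof.
split=> [||t t4]; [by rewrite g1_lo; lra|by rewrite g1_ge3; lra|].
have [t2|t2] := leP t 2; first by rewrite g1_lo; lra.
have [t7|t7] := leP t (7 / 3); first by rewrite g1_mid; lra.
by have [t3|t3] := leP t 3; [rewrite g1_hi|rewrite g1_ge3]; lra.
Qed.

Lemma h1_stable04 : stable04 h1.
Proof.
split=> [||t t4]; [by rewrite h1_lo; lra|by rewrite h1_ge3; lra|].
have [t2|t2] := leP t (2 / 3); first by rewrite h1_lo; lra.
have [t1|t1] := leP t 1; first by rewrite h1_mid; lra.
by have [t3|t3] := leP t 3; [rewrite h1_hi|rewrite h1_ge3]; lra.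
Qed.

(** * The generators of the system *)

Definition gen (i : 'I_4) : circle R -> circle R :=
  nth idfun [:: idfun; half_turn; lift g0; lift g1] i.

Definition gen_inv (i : 'I_4) : circle R -> circle R :=
  nth idfun [:: idfun; half_turn; lift h0; lift h1] i.

Lemma genK i : cancel (gen i) (gen_inv i).
Proof.
case: i => -[|[|[|[|//]]]] ?; rewrite /gen /gen_inv/=.
- by [].
- exact: half_turnK.
- exact: (lift_cancel g0_stable04 h0_stable04 g0K).
- exact: (lift_cancel g1_stable04 h1_stable04 g1K).
Qed.

Lemma gen_invK i : cancel (gen_inv i) (gen i).
Proof.
case: i => -[|[|[|[|//]]]] ?; rewrite /gen /gen_inv/=.
- by [].
- exact: half_turnK.
- exact: (lift_cancel h0_stable04 g0_stable04 h0K).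
- exact: (lift_cancel h1_stable04 g1_stable04 h1K).
Qed.

Lemma continuous_lift_stable04 F : stable04 F -> continuous F ->
  continuous (lift F).
Proof. by move=> [F0 F4 _]; apply: continuous_lift; rewrite F0 F4 expc04. Qed.

Lemma continuous_half_turn : continuous half_turn.
Proof.
apply: continuous_lift; first by rewrite -expcD4/=; congr expc; lra.
by continuity_affine (1 : R) (2 : R).
Qed.

Lemma continuous_gen i : continuous (gen i).
Proof.
case: i => -[|[|[|[|//]]]] ?; rewrite /gen/=.
- by move=> z; exact: cvg_id.
- exact: continuous_half_turn.
- exact: (continuous_lift_stable04 g0_stable04 continuous_g0).
- exact: (continuous_lift_stable04 g1_stable04 continuous_g1).
Qed.

Lemma continuous_gen_inv i : continuous (gen_inv i).
Proof.
case: i => -[|[|[|[|//]]]] ?; rewrite /gen_inv/=.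
- by move=> z; exact: cvg_id.
- exact: continuous_half_turn.
- exact: (continuous_lift_stable04 h0_stable04 continuous_h0).
- exact: (continuous_lift_stable04 h1_stable04 continuous_h1).
Qed.

(** * Forward minimality *)

Lemma gen_forward_minimal : forward_minimal gen.
Proof.
apply: forward_minimal_generators => K cK [z Kz] genKK.
have i3 (i : nat) (H : (i < 4)%N) w : K w -> K (gen (Ordinal H) w).
  by move=> Kw; apply: (genKK (Ordinal H)); exists w.
pose Q t := K (expc t).
have Qex : exists t, 0 <= t < 4 /\ Q t.
  by have [t [t4 tz]] := expc_surj z; exists t; rewrite /Q tz.
(* Symbol 1 is the half turn, 2 is the lift of [g0] and 3 the lift of [g1]. *)
have QD2 t : 0 <= t <= 2 -> Q t -> Q (t + 2).
  by move=> t2 /(i3 1%N isT); rewrite /gen/= half_turn_expc//; lra.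
have QB2 t : 2 <= t <= 4 -> Q t -> Q (t - 2).
  by move=> t2 /(i3 1%N isT); rewrite /gen/= half_turn_expc_sub.
have Q0 t : 1 <= t <= 4 -> Q t -> Q ((t + 8) / 3).
  move=> t2 /(i3 2%N isT); rewrite /gen/= (lift_stable04 g0_stable04); last by lra.
  by rewrite g0_hi//; lra.
have Q1 t : 0 <= t <= 2 -> Q t -> Q (t / 3).
  move=> t2 /(i3 3%N isT); rewrite /gen/= (lift_stable04 g1_stable04); last by lra.
  by rewrite g1_lo//; lra.
have Q2 t : 2 <= t <= 7 / 3 -> Q t -> Q (t - 4 / 3).
  move=> t2 /(i3 3%N isT); rewrite /gen/= (lift_stable04 g1_stable04); last by lra.
  by rewrite g1_mid//; lra.
have dense := meets_itv Qex QD2 QB2 Q0 Q1 Q2.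
apply/seteqP; split => // w _; have [t [t4 <-]] := expc_surj w.
have /continuous_closedP/(_ _ cK) cQ := @continuous_expc R.
have /closure_id QE := cQ; suff : (@expc R @^-1` K) t by [].
rewrite QE => U /nbhs_ballP[e /= e0 eU].
(* Searching to the right of [t], cut off at 4, keeps the interval non-empty because [t < 4]. *)
have [|||s [ts Qs]] := dense t (Num.min 4 (t + e)).
- by lra.
- by rewrite lt_min; apply/andP; split; lra.
- by rewrite ge_min lexx.
exists s; split => //; apply: eU; move: ts; rewrite lt_min => /and3P[ts s4 se].
by rewrite /ball/= ltr0_norm; lra.
Qed.

(* The left end points of the construction intervals of the ternary Cantor set;
   they are dense in it, and avoid a discussion of the Cantor set itself. *)
Inductive endpoint : R -> Prop :=
| endpoint0 : endpoint 0
| endpoint_left t : endpoint t -> endpoint (t / 3)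
| endpoint_right t : endpoint t -> endpoint (t / 3 + 2 / 3).

Lemma endpoint_itv t : endpoint t -> 0 <= t <= 1.
Proof. by elim=> [|{}t _|{}t _]; lra. Qed.

Definition endpoints := @expc R @` [set t | endpoint t \/ endpoint (t - 2)].

Lemma expc_endpoint t : endpoint t -> endpoints (expc t).
Proof. by move=> et; exists t => //; left. Qed.

Lemma expc_endpointD2 t : endpoint t -> endpoints (expc (t + 2)).
Proof. by move=> et; exists (t + 2) => //; right; rewrite addrK. Qed.

(** All parameters are at most 3, where [h0] is [t / 3]: it sends C to its left third and C + 2 to
    the right third of C. *)
Lemma lift_h0_endpoints z : endpoints z -> endpoints (lift h0 z).
Proof.
move=> [t + <-] => -[et|et]; have := endpoint_itv et => t1;
  rewrite (lift_stable04 h0_stable04) ?h0_lo; try lra.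
- exact/expc_endpoint/endpoint_left.
- have -> : t / 3 = (t - 2) / 3 + 2 / 3 by lra.
  exact/expc_endpoint/endpoint_right.
Qed.

(** [h1] blows the left third of C up to C, translates the right third to the left third of C + 2,
    and contracts C + 2 to its own right third. *)
Lemma lift_h1_endpoints z : endpoints z -> endpoints (lift h1 z).
Proof.
move=> [t + <-] => -[et|et]; have := endpoint_itv et => t1;
  rewrite (lift_stable04 h1_stable04); try lra; last first.
  have -> : h1 t = (t - 2) / 3 + 2 / 3 + 2 by rewrite h1_hi; lra.
  exact/expc_endpointD2/endpoint_right.
case: et t1 => [|s es|s es] _; first by rewrite h1_lo ?mulr0; [exact/expc_endpoint/endpoint0|lra].
  have s1 := endpoint_itv es; have -> : h1 (s / 3) = s by rewrite h1_lo; lra.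
  exact: expc_endpoint.
have s1 := endpoint_itv es; have -> : h1 (s / 3 + 2 / 3) = s / 3 + 2 by rewrite h1_mid; lra.
exact/expc_endpointD2/endpoint_left.
Qed.

Lemma half_turn_endpoints z : endpoints z -> endpoints (half_turn z).
Proof.
move=> [t + <-] => -[et|et]; have := endpoint_itv et => t1.
  by rewrite half_turn_expc; [exact: expc_endpointD2|lra].
by rewrite half_turn_expc_sub; [exact: expc_endpoint|lra].
Qed.

Lemma gen_inv_endpoints i z : endpoints z -> endpoints (gen_inv i z).
Proof.
case: i => -[|[|[|[|//]]]] ?; rewrite /gen_inv/=.
- by [].
- exact: half_turn_endpoints.
- exact: lift_h0_endpoints.
- exact: lift_h1_endpoints.
Qed.

(** The preimage under a generator is the image under its continuous inverse, which preserves
    [endpoints]. *)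
Lemma preimage_closure_endpoints i :
  gen i @^-1` closure endpoints `<=` closure endpoints.
Proof.
move=> z /= clz; rewrite -[z](genK i).
have : (gen_inv i @` closure endpoints) (gen_inv i (gen i z)).
  by exists (gen i z).
move=> /(image_closure (@continuous_gen_inv i)); apply: closureS.
by move=> _ [w ew <-]; exact: gen_inv_endpoints.
Qed.

Lemma closure_endpoints_neq0 : closure endpoints !=set0.
Proof. by exists (expc 0); apply/subset_closure/expc_endpoint/endpoint0. Qed.

Lemma closure_endpoints_neqT : closure endpoints != setT.
Proof.
apply/eqP => clT; pose C := @expc R @` `[0, 1] `|` @expc R @` `[2, 3].
have cC : closed C.
  by apply: closedU; apply: compact_closed; try exact: hausdorff_circle;
     exact: compact_expc.
have eC : endpoints `<=` C.
  move=> _ [t [|]/endpoint_itv t1 <-]; [left|right]; exists t => //=.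
  by rewrite in_itv/=; lra.
(* The parameter 3/2 is the midpoint of the gap (1, 2), which both arcs of [C] avoid. *)
have : C (expc (3 / 2)).
  have /closure_id -> := cC; apply: (closureS eC); by rewrite clT.
by case=> -[t /=]; rewrite in_itv/= => t1 /expc_inj E;
  have : t = 3 / 2 by [apply: E; lra]; lra.
Qed.

End circle_maps.

Theorem corollary2 (R : realType) :
  exists (k : nat) (f : 'I_k.+1 -> circle R -> circle R),
    [/\ forall i, homeomorphism (f i),
        forward_minimal f,
        ~ backward_minimal f,
        whole_space_strict_attractor f &
        forall P : probability (borel_code k) R,
          minorized_transitions P -> ~ renderable f P].
Proof.
have gen_surj i (z : circle R) : exists x, gen i x = z.
  by exists (gen_inv i z); rewrite gen_invK.
have fm := @gen_forward_minimal R.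
exists 3%N, (@gen R); split => //.
- move=> i; split; first exact: continuous_gen.
  exists (gen_inv i); split; [exact: continuous_gen_inv|exact: genK|exact: gen_invK].
- exact: (not_backward_minimal gen_surj (@closed_closure _ _)
    (closure_endpoints_neq0 R) (closure_endpoints_neqT R) (@preimage_closure_endpoints R)).
- apply: forward_minimal_strict_attractor => //; first exact: continuous_gen.
  (* Symbol 0 is the identity. *)
  by exists ord0.
- move=> P _; exact: (not_renderable (@compact_circle R) (@continuous_gen R) gen_surj
    (@closed_closure _ _) (closure_endpoints_neq0 R) (closure_endpoints_neqT R)
    (@preimage_closure_endpoints R)).
Qed.
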